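(* Let $B$ be an $n\times n$ matrix with entries in $\{0,1\}$. Then there is a $3$-nilpotent semigroup $S$ (with zero $z$) and an element $z'\in S\setminus\{z\}$ such that if $M=S\cup\{I\}$ is obtained from $S$ by adjoining an identity $I$, then the contracted semigroup determinant of $M$ is $\widetilde\theta_M=-\det B\cdot x_{z'}^{n+2}$. Moreover, if $B$ is symmetric, then $M$ is commutative.
   Context: A semigroup $S$ is $3$-nilpotent if it has a zero $z$ and the product of any three elements of $S$ is $z$. For a finite semigroup $M$ with zero $z$, the contracted semigroup determinant $\widetilde\theta_M\in\mathbb C[x_m\mid m\in M\setminus\{z\}]$ is the determinant of the $(M\setminus\{z\})\times(M\setminus\{z\})$ matrix with $(s,t)$-entry $x_{st}$ if $st\neq z$ and $0$ if $st=z$. *)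

(* Defs.v *)
From HB Require Import structures.
From mathcomp Require Import all_boot all_order all_algebra.
From mathcomp Require Import reals.
From mathcomp Require Export complex.
From mathcomp Require Export mpoly.

Set Implicit Arguments.
Unset Strict Implicit.
Unset Printing Implicit Defensive.

Import GRing.Theory.

Local Open Scope group_scope.

#[short(type="finSemigroupType")]
HB.structure Definition FinSemigroup := { S of Finite S & Semigroup S }.

Definition is_zero (S : semigroupType) (z : S) : Prop :=
  forall a : S, z * a = z /\ a * z = z.

Definition three_nilpotent (S : semigroupType) (z : S) : Prop :=
  is_zero z /\ forall a b c : S, a * b * c = z.

(* S together with a new identity, encoded as None; s : S becomes Some s. *)
Definition adjoin_one (S : Type) : Type := option S.

Section AdjoinOne.

Variable S : finSemigroupType.

HB.instance Definition _ := Finite.copy (adjoin_one S) (option S).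

Definition adjoin_one_mul (x y : adjoin_one S) : adjoin_one S :=
  match x, y with
  | None, _ => y
  | _, None => x
  | Some a, Some b => Some (a * b)
  end.

Lemma adjoin_one_mulA : associative adjoin_one_mul.
Proof. by move=> [a|] [b|] [c|] //=; rewrite mulgA. Qed.

Lemma adjoin_one_mul1x : left_id (None : adjoin_one S) adjoin_one_mul.
Proof. by case. Qed.

Lemma adjoin_one_mulx1 : right_id (None : adjoin_one S) adjoin_one_mul.
Proof. by case. Qed.

HB.instance Definition _ := isMonoid.Build (adjoin_one S)
  adjoin_one_mulA adjoin_one_mul1x adjoin_one_mulx1.

HB.instance Definition _ := FinSemigroup.on (adjoin_one S).

Definition to_adjoin_one (s : S) : adjoin_one S := Some s.

Lemma is_zero_to_adjoin_one (z : S) : is_zero z -> is_zero (to_adjoin_one z).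
Proof. by move=> z0 [a|] //; have [za az] := z0 a; split; congr Some. Qed.

End AdjoinOne.

Section ContractedDeterminant.

Variables (R : comNzRingType) (M : finSemigroupType) (z : M).

(* z is meant to be the zero of M. Polynomial variables and matrix rows and
   columns are indexed by M \ {z} through its enumeration; the determinant does
   not depend on the enumeration, as rows and columns use the same one. *)
Definition contracted_index : finType := {m : M | m != z}.

Local Notation contracted_poly := {mpoly R[#|contracted_index|]}.

(* x_m if m != z, and 0 if m = z *)
Definition contracted_var (m : M) : contracted_poly :=
  if insub m is Some u then 'X_(enum_rank (u : contracted_index)) else 0%R.

Definition contracted_matrix : 'M[contracted_poly]_#|contracted_index| :=
  \matrix_(i, j) contracted_var (val (enum_val i) * val (enum_val j)).

Definition contracted_det : contracted_poly := \det contracted_matrix.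

End ContractedDeterminant.

(* Main.v *)
Require Import Defs.
From HB Require Import structures.
From mathcomp Require Import all_boot all_order all_algebra all_fingroup.
From mathcomp Require Import reals.

(** Take S = {x_1, ..., x_n, z', z}, where x_i x_j is z' if B_ij = 1 and z
    otherwise, and all other products are z. With M \ {z} ordered as
    z', I, x_1, ..., x_n, exchanging the first two rows of the matrix of M makes
    it block triangular with diagonal blocks x_z', x_z' and x_z' B. *)

Import GRing.Theory.

Local Open Scope ring_scope.

(** Between index sets of equal size [f] is a permutation. It acts on both rows and columns, so its
    sign occurs twice and cancels. *)
Lemma det_mxsub_inj {R : comNzRingType} {m p : nat} (A : 'M[R]_m)
    (f : 'I_p -> 'I_m) :
  p = m -> injective f -> \det (mxsub f f A) = \det A.
Proof.
move=> pm; move: f; rewrite {p}pm => f f_inj.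
have -> : mxsub f f A = row_perm (perm f_inj) (col_perm (perm f_inj) A).
  by apply/matrixP => i j; rewrite !mxE !permE.
rewrite row_permE col_permE !det_mulmx !det_perm odd_permV mulrCA.
by rewrite -signr_addb addbb mulr1.
Qed.

Lemma det_antitriangular_border {R : comNzRingType} {n : nat} (x a : R)
    (r : 'rV[R]_n) (c : 'cV[R]_n) (D : 'M[R]_n) :
  \det (block_mx 0 (row_mx x%:M 0) (col_mx x%:M 0) (block_mx a%:M r c D)
        : 'M_(1 + (1 + n))) = - (x ^+ 2 * \det D).
Proof.
set A := (X in \det X).
pose i0 : 'I_(1 + (1 + n)) := lshift _ 0.
pose i1 : 'I_(1 + (1 + n)) := rshift 1 (lshift n 0).
have detA : \det (xrow i0 i1 A) = - \det A.
  by rewrite xrowE det_mulmx det_perm odd_tperm /= expr1 mulN1r.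
(* The exchanged rows are [(x, a, r)] and [(0, x, 0)], followed by the rows of [(0, c, D)]: upper
   block triangular, with a lower block triangular second diagonal block. *)
have xA : xrow i0 i1 A
    = block_mx x%:M (row_mx a%:M r) 0 (block_mx x%:M 0 c D).
  apply/matrixP => i j; rewrite mxE.
  case: (split_ordP i) => k ->.
    rewrite [k]ord1 tpermL /A /i1.
    case: (split_ordP j) => l ->.
      by rewrite !(block_mxEul, block_mxEdl, col_mxEu).
    by rewrite block_mxEdr block_mxEur; case: (split_ordP l) => l' ->;
      rewrite ?(block_mxEul, block_mxEur, row_mxEl, row_mxEr).
  case: (split_ordP k) => k' ->.
    rewrite [k']ord1 tpermR /A /i0.
    case: (split_ordP j) => l ->.
      by rewrite block_mxEul block_mxEdl !mxE.
    rewrite block_mxEur block_mxEdr.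
    by case: (split_ordP l) => l' ->;
      rewrite ?(block_mxEul, block_mxEur, row_mxEl, row_mxEr).
  rewrite tpermD // /A.
  case: (split_ordP j) => l ->; first by rewrite !block_mxEdl col_mxEd !mxE.
  rewrite !block_mxEdr.
  by case: (split_ordP l) => l' ->; rewrite ?(block_mxEdl, block_mxEdr).
by rewrite -[LHS]opprK -detA xA det_ublock det_lblock !det_scalar1 mulrA.
Qed.

Section SquareSemigroup.

Context {T : finType} (e : rel T).

(* [None] is the zero and [Some None] the common value of all nonzero products;
   the vacuous [let] makes the semigroup instance depend on [e]. *)
Definition square_semigroup : Type := let _ := e in option (option T).

HB.instance Definition _ :=
  Finite.copy square_semigroup (option (option T)).

Definition square_semigroup_mul (a b : square_semigroup) : square_semigroup :=
  match a, b with
  | Some (Some s), Some (Some t) => if e s t then Some None else None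
  | _, _ => None
  end.

(** A nonzero product needs two generators as factors, and no product is a generator. Hence both
    bracketings of a triple product are zero. *)
Lemma square_semigroup_mulA : associative square_semigroup_mul.
Proof. by move=> [[s|]|] [[t|]|] [[u|]|] //=; do ?case: ifP. Qed.

HB.instance Definition _ :=
  isSemigroup.Build square_semigroup square_semigroup_mulA.

HB.instance Definition _ := FinSemigroup.on square_semigroup.

Definition square_zero : square_semigroup := None.
Definition square_top : square_semigroup := Some None.
Definition square_gen (t : T) : square_semigroup := Some (Some t).

Lemma square_zero_three_nilpotent : three_nilpotent square_zero.
Proof.
split=> [[[s|]|]|] //.
by move=> [[s|]|] [[t|]|] [[u|]|] //; rewrite /mul/=; case: ifP.
Qed.

Lemma square_gen_mul (s t : T) :
  (square_gen s * square_gen t)%g = if e s t then square_top else square_zero.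
Proof. by []. Qed.

Lemma square_semigroup_comm :
  symmetric e -> forall a b : square_semigroup, (a * b = b * a)%g.
Proof. by move=> eC [[s|]|] [[t|]|] //; rewrite /mul/= eC. Qed.

End SquareSemigroup.

Lemma adjoin_one_comm {S : finSemigroupType} :
  (forall a b : S, (a * b = b * a)%g) ->
  forall a b : adjoin_one S, (a * b = b * a)%g.
Proof. by move=> SC [a|] [b|] //; congr Some; apply: SC. Qed.

Lemma contracted_var_zero (R : comNzRingType) {M : finSemigroupType} (z : M) :
  contracted_var R z z = 0.
Proof. by rewrite /contracted_var insubN // negbK. Qed.

(** Replaces the opaque enumeration of rows and columns by an explicit listing [h]. By cardinality
    [h] runs through all of [M] except [z]; the polynomial variables keep their original indices. *)
Lemma contracted_det_reindex (R : comNzRingType) {M : finSemigroupType} (z : M)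
    {p : nat} (h : 'I_p -> M) :
  p.+1 = #|M| -> injective h -> (forall k, h k != z) ->
  contracted_det R z = \det (\matrix_(i, j) contracted_var R z (h i * h j)%g).
Proof.
move=> cardM h_inj hz.
pose u k : contracted_index z := exist _ (h k) (hz k).
have u_inj : injective u by move=> i j [/h_inj].
have cardu : p = #|contracted_index z|.
  by rewrite card_sig -[p]/(p.+1.-1) cardM -(cardC1 z).
have f_inj : injective (enum_rank \o u).
  by apply: inj_comp u_inj; apply: enum_rank_inj.
rewrite /contracted_det -(det_mxsub_inj _ _ cardu f_inj); congr (\det _).
by apply/matrixP => i j; rewrite !mxE /= !enum_rankK.
Qed.

Section SquareSemigroupDeterminant.

Context {n : nat} (e : rel 'I_n).

Local Notation S := (square_semigroup e).

(** The nested sum [1 + (1 + n)] matches the blocks of [det_antitriangular_border]. *)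
Definition square_index (k : 'I_(1 + (1 + n))) : adjoin_one S :=
  match split k with
  | inl _ => to_adjoin_one (square_top e)
  | inr l => match split l with
             | inl _ => None
             | inr i => to_adjoin_one (square_gen e i)
             end
  end.

Lemma square_index_inj : injective square_index.
Proof.
move=> k l; rewrite /square_index.
case: (split_ordP k) => k' ->; case: (split_ordP l) => l' ->.
- by rewrite [k']ord1 [l']ord1.
- by case: (split l').
- by case: (split k').
case: (split_ordP k') => k'' ->; case: (split_ordP l') => l'' -> //.
  by rewrite [k'']ord1 [l'']ord1.
by case=> ->.
Qed.

Lemma square_index_neq0 k :
  square_index k != to_adjoin_one (square_zero e).
Proof. by rewrite /square_index; case: split => // l; case: split. Qed.

Lemma contracted_det_square (R : comNzRingType) :
  contracted_det R (to_adjoin_one (square_zero e))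
  = (- \det (\matrix_(i, j) (e i j)%:R : 'M[R]_n))%:MP
    * contracted_var R (to_adjoin_one (square_zero e))
        (to_adjoin_one (square_top e)) ^+ (n + 2).
Proof.
set z := to_adjoin_one (square_zero e); set v := contracted_var R z.
set x := v _.
rewrite (contracted_det_reindex _ _ square_index); first last.
- exact: square_index_neq0.
- exact: square_index_inj.
(* The monoid is three nested options over ['I_n], so it has [n + 3] elements, one more than there
   are indices. *)
- by rewrite !card_option card_ord.
pose D := x *: map_mx (@mpolyC _ R) (\matrix_(i, j) (e i j)%:R : 'M[R]_n).
(* The common product [square_top] gives [x] against the identity and zero against itself and the
   generators. The identity against itself gives [v None], and against the generators the row and
   column of their variables. *)
transitivity (\det (block_mx 0 (row_mx x%:M 0) (col_mx x%:M 0)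
  (block_mx (v None)%:M (\row_j v (to_adjoin_one (square_gen e j)))
     (\col_i v (to_adjoin_one (square_gen e i))) D) : 'M_(1 + (1 + n)))).
  congr (\det _); apply/matrixP => i j; rewrite mxE -/v /square_index.
  case: (split_ordP i) => k ->; case: (split_ordP j) => l ->.
  - by rewrite block_mxEul mxE; apply: contracted_var_zero.
  - rewrite block_mxEur; case: (split_ordP l) => l' ->.
      by rewrite row_mxEl [k]ord1 [l']ord1 mxE.
    by rewrite row_mxEr mxE; apply: contracted_var_zero.
  - rewrite block_mxEdl; case: (split_ordP k) => k' ->.
      by rewrite col_mxEu [l]ord1 [k']ord1 mxE.
    by rewrite col_mxEd mxE; apply: contracted_var_zero.
  rewrite block_mxEdr.
  case: (split_ordP k) => k' ->; case: (split_ordP l) => l' ->.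
  - by rewrite block_mxEul [k']ord1 [l']ord1 mxE.
  - by rewrite block_mxEur mxE.
  - by rewrite block_mxEdl mxE.
  rewrite block_mxEdr !mxE /v /mul/= square_gen_mul.
  case: (e k' l'); first by rewrite mpolyC1 mulr1.
  by rewrite mpolyC0 mulr0; apply: contracted_var_zero.
(* The border contributes [x ^+ 2], and scaling the block of size [n] contributes [x ^+ n]. *)
rewrite det_antitriangular_border detZ det_map_mx mulrA -exprD addnC.
by rewrite mulrC rmorphN mulNr.
Qed.

End SquareSemigroupDeterminant.

Theorem proposition5p4 (R : realType) (n : nat) (B : 'M[R[i]]_n)
    (B01 : forall i j, B i j = 0 \/ B i j = 1) :
  exists (S : finSemigroupType) (z z' : S),
    [/\ three_nilpotent z,
        z' != z,
        contracted_det R[i] (to_adjoin_one z)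
          = (- \det B)%:MP *
            contracted_var R[i] (to_adjoin_one z) (to_adjoin_one z') ^+ (n + 2)
      & B^T = B -> forall a b : adjoin_one S, (a * b = b * a)%g].
Proof.
pose e : rel 'I_n := fun i j => B i j == 1.
(* As the entries are 0 or 1 and these differ, [B] is the indicator matrix of the relation [e]. *)
have BE : B = \matrix_(i, j) (e i j)%:R.
  apply/matrixP => i j; rewrite mxE /e.
  by case: (B01 i j) => ->; rewrite ?eqxx // eq_sym oner_eq0.
exists (square_semigroup e), (square_zero e), (square_top e); split=> //.
- exact: square_zero_three_nilpotent.
- by rewrite [in RHS]BE contracted_det_square.
- move=> BT; apply: adjoin_one_comm; apply: square_semigroup_comm => i j.
  by rewrite /e -[in LHS]BT mxE.
Qed.
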